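(* Let $A\in\mathbb{R}^{m\times n}$, $b\in\mathbb{R}^m$, $c\in\mathbb{R}^n$, and let $\mathrm{BP}$ be the associated binary program, with $\operatorname{Fes}(\mathrm{BP})\neq\emptyset$. Then there exists an $\epsilon>0$ such that for all $x^{*}\oplus y^{*}\oplus z^{*}\in\operatorname{Opt}(\mathrm{BPD})$ one has $\operatorname{d}(\mathrm{BP})=n-e^{T}z^{*}$. Analogously, there exists an $\epsilon>0$ such that for all $x^{*}\oplus y^{*}\oplus z^{*}\in\operatorname{Opt}(\overline{\mathrm{BPD}})$ one has $\operatorname{d}(\mathrm{BP})\leq n-e^{T}z^{*}$. (Here $\mathrm{BPD}$ and $\overline{\mathrm{BPD}}$ are taken with the parameter $\epsilon$ in question.)
   Context: The binary program $\mathrm{BP}$ is: maximize $c^{T}x$ subject to $Ax\leq b$, $x\in\{0,1\}^{n}$. For any binary program, $\operatorname{Fes}$ denotes its set of feasible solutions and $\operatorname{Opt}$ its set of optimal solutions (feasible solutions maximizing the objective). The optimal diameter is $\operatorname{d}(\mathrm{BP})=\max_{x^{*},y^{*}\in\operatorname{Opt}(\mathrm{BP})}\|x^{*}-y^{*}\|^{2}$ with $\|\cdot\|$ the Euclidean norm. $x\oplus y\oplus z$ denotes concatenation of vectors and $e$ is the all-ones vector. For $\epsilon>0$, $\mathrm{BPD}$ is the binary program: maximize $c^{T}(x+y)-\epsilon e^{T}z$ subject to $Ax\leq b$, $Ay\leq b$, $x+y-z\leq e$, $-x-y-z\leq -e$, and $x,y,z\in\{0,1\}^{n}$ (its solutions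 are the vectors $x\oplus y\oplus z\in\{0,1\}^{3n}$). $\overline{\mathrm{BPD}}$ is $\mathrm{BPD}$ with the constraint $-x-y-z\leq -e$ removed. *)

(* Defs.v *)
From HB Require Import structures.
From mathcomp Require Import all_boot all_order all_algebra.
From mathcomp Require Import reals.

Set Implicit Arguments.
Unset Strict Implicit.
Unset Printing Implicit Defensive.
Import Order.TTheory GRing.Theory Num.Theory.
Local Open Scope ring_scope.

(** The program: maximize [obj^T x] subject to [lhs x <= rhs], [x] in {0,1}^n. *)
Record binprog (R : realType) (m n : nat) := BinProg {
  lhs : 'M[R]_(m, n);
  rhs : 'cV[R]_m;
  obj : 'cV[R]_n }.

(** {0,1}^n is the finite type ['cV[bool]_n]; [realv] embeds it in R^n. *)
Definition realv (R : realType) (n : nat) (x : 'cV[bool]_n) : 'cV[R]_n :=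
  map_mx (fun t : bool => (nat_of_bool t)%:R) x.
Arguments realv R {n} x.

Definition ones (R : realType) (n : nat) : 'cV[R]_n := const_mx 1.
Arguments ones R n : clear implicits.

Definition dot (R : realType) (n : nat) (u v : 'cV[R]_n) : R :=
  (u^T *m v) ord0 ord0.

(** The library norm on matrices is the sup norm, hence this definition. *)
Definition enorm (R : realType) (n : nat) (u : 'cV[R]_n) : R :=
  Num.sqrt (\sum_(i < n) u i ord0 ^+ 2).

Definition Fes (R : realType) (m n : nat) (P : binprog R m n)
    : {set 'cV[bool]_n} :=
  [set x | [forall i, (lhs P *m realv R x) i ord0 <= rhs P i ord0]].

Definition Opt (R : realType) (m n : nat) (P : binprog R m n)
    : {set 'cV[bool]_n} :=
  [set x in Fes P |
    [forall y in Fes P, dot (obj P) (realv R y) <= dot (obj P) (realv R x)]].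

(** The terms are nonnegative, so the base value 0 only matters when
    [Opt P] is empty. *)
Definition optdiam (R : realType) (m n : nat) (P : binprog R m n) : R :=
  \big[Num.max/0]_(x in Opt P) \big[Num.max/0]_(y in Opt P)
    enorm (realv R x - realv R y) ^+ 2.

Definition concat3 (T : Type) (n : nat) (x y z : 'cV[T]_n)
    : 'cV[T]_(n + (n + n)) :=
  col_mx x (col_mx y z).

Definition BPD (R : realType) (m n : nat) (P : binprog R m n) (eps : R)
    : binprog R (m + (m + (n + n))) (n + (n + n)) :=
  let A := lhs P in
  BinProg
    (col_mx (row_mx A (row_mx 0 0))
    (col_mx (row_mx 0 (row_mx A 0))
    (col_mx (row_mx 1%:M (row_mx 1%:M (- 1%:M)))
            (row_mx (- 1%:M) (row_mx (- 1%:M) (- 1%:M))))))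
    (col_mx (rhs P) (col_mx (rhs P) (col_mx (ones R n) (- ones R n))))
    (concat3 (obj P) (obj P) (- (eps *: ones R n))).

Definition BPDbar (R : realType) (m n : nat) (P : binprog R m n) (eps : R)
    : binprog R (m + (m + n)) (n + (n + n)) :=
  let A := lhs P in
  BinProg
    (col_mx (row_mx A (row_mx 0 0))
    (col_mx (row_mx 0 (row_mx A 0))
            (row_mx 1%:M (row_mx 1%:M (- 1%:M)))))
    (col_mx (rhs P) (col_mx (rhs P) (ones R n)))
    (concat3 (obj P) (obj P) (- (eps *: ones R n))).

Lemma forall_col_mx (R : realType) (p q : nat) (u1 v1 : 'cV[R]_p)
    (u2 v2 : 'cV[R]_q) :
  [forall i, col_mx u1 u2 i ord0 <= col_mx v1 v2 i ord0] =
  [forall i, u1 i ord0 <= v1 i ord0] && [forall i, u2 i ord0 <= v2 i ord0].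
Proof.
apply/forallP/andP => [h|[/forallP h1 /forallP h2] i].
  split; apply/forallP => i.
    by have := h (lshift q i); rewrite !col_mxEu.
  by have := h (rshift p i); rewrite !col_mxEd.
by case: (split_ordP i) => j ->; rewrite ?col_mxEu ?col_mxEd.
Qed.

Lemma realv_concat3 (R : realType) (n : nat) (x y z : 'cV[bool]_n) :
  realv R (concat3 x y z) = concat3 (realv R x) (realv R y) (realv R z).
Proof. by rewrite /realv /concat3 !map_col_mx. Qed.

Lemma in_Fes_BPD (R : realType) (m n : nat) (P : binprog R m n) (eps : R)
    (x y z : 'cV[bool]_n) :
  let X := realv R x in let Y := realv R y in let Z := realv R z in
  (concat3 x y z \in Fes (BPD P eps)) =
  [&& x \in Fes P, y \in Fes P,
      [forall i, (X + Y - Z) i ord0 <= ones R n i ord0] &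
      [forall i, (- X - Y - Z) i ord0 <= (- ones R n) i ord0]].
Proof.
rewrite /= !inE realv_concat3 /= /concat3 !mul_col_mx !mul_row_col.
by rewrite !mul0mx !mulNmx !mul1mx !addr0 !add0r !forall_col_mx !addrA.
Qed.

Lemma in_Fes_BPDbar (R : realType) (m n : nat) (P : binprog R m n) (eps : R)
    (x y z : 'cV[bool]_n) :
  let X := realv R x in let Y := realv R y in let Z := realv R z in
  (concat3 x y z \in Fes (BPDbar P eps)) =
  [&& x \in Fes P, y \in Fes P &
      [forall i, (X + Y - Z) i ord0 <= ones R n i ord0]].
Proof.
rewrite /= !inE realv_concat3 /= /concat3 !mul_col_mx !mul_row_col.
by rewrite !mul0mx !mulNmx !mul1mx !addr0 !add0r !forall_col_mx !addrA.
Qed.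

Lemma obj_BPD (R : realType) (m n : nat) (P : binprog R m n) (eps : R)
    (x y z : 'cV[bool]_n) :
  dot (obj (BPD P eps)) (realv R (concat3 x y z)) =
  dot (obj P) (realv R x + realv R y) - eps * dot (ones R n) (realv R z).
Proof.
rewrite realv_concat3 /dot /= /concat3 !tr_col_mx !mul_row_col mulmxDr.
by rewrite linearN linearZ /= mulNmx -scalemxAl !mxE addrA.
Qed.

Lemma obj_BPDbar (R : realType) (m n : nat) (P : binprog R m n) (eps : R) :
  obj (BPDbar P eps) = obj (BPD P eps).
Proof. by []. Qed.

(* Main.v *)
Require Import Defs.
From HB Require Import structures.
From mathcomp Require Import all_boot all_order all_algebra.
From mathcomp Require Import reals.
From mathcomp Require Import lra.

Set Implicit Arguments.
Unset Strict Implicit.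
Unset Printing Implicit Defensive.
Import Order.TTheory GRing.Theory Num.Theory.
Local Open Scope ring_scope.

(** For 0/1 vectors, [||x - y||^2] is the number of coordinates where [x] and
    [y] differ, that is [n - e^T z] for [z] the indicator of the coordinates
    where they agree ([enorm_sub_agree]).

    A pair of optimal solutions of the base program, completed by its agreement
    vector, is feasible for the doubled program, with or without the second
    linking constraint.  If [eps] is so small that [eps * n] is below the gap
    between the optimal value and the other values of the objective on feasible
    solutions ([small_penalty_exists]), then the penalty [eps e^T z] cannot
    compensate for a suboptimal [x] or [y].  An optimal triple [(x, y, z)] therefore has
    [x] and [y] optimal, and the objective being then constant on pairs of
    optimal solutions, [e^T z] is at most the size of every agreement vector of
    such a pair: the diameter is at most [n - e^T z] ([dominating_triple]).

    The second linking constraint provides the converse inequality: with it, [z]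
    dominates the agreement vector of [x] and [y], so [n - e^T z] is at
    most [||x - y||^2], which is one of the values whose maximum is the
    diameter. *)

Section BinaryVectors.
Variables (R : realType) (n : nat).
Implicit Types x y z : 'cV[bool]_n.

Definition agree x y : 'cV[bool]_n := \col_i (x i ord0 == y i ord0).

Lemma dot_ones z : dot (ones R n) (realv R z) = \sum_i (z i ord0)%:R.
Proof. by rewrite /dot mxE; apply: eq_bigr => i _; rewrite !mxE mul1r. Qed.

Lemma dot_ones_ge0 z : 0 <= dot (ones R n) (realv R z).
Proof. by rewrite dot_ones sumr_ge0 // => i _; rewrite ler0n. Qed.

Lemma natr_sum1 : n%:R = \sum_(i < n) 1 :> R.
Proof. by rewrite sumr_const card_ord. Qed.

Lemma dot_ones_le z : dot (ones R n) (realv R z) <= n%:R.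
Proof.
rewrite dot_ones natr_sum1; apply: ler_sum => i _.
by rewrite lern1 leq_b1.
Qed.

Lemma enorm_sub_agree x y :
  enorm (realv R x - realv R y) ^+ 2 =
  n%:R - dot (ones R n) (realv R (agree x y)).
Proof.
rewrite sqr_sqrtr; last by apply: sumr_ge0 => i _; exact: sqr_ge0.
rewrite dot_ones natr_sum1 -sumrB; apply: eq_bigr => i _.
by rewrite !mxE; case: (x i ord0); case: (y i ord0) => /=; lra.
Qed.

Lemma dotDr (c u v : 'cV[R]_n) : dot c (u + v) = dot c u + dot c v.
Proof. by rewrite /dot mulmxDr mxE. Qed.

End BinaryVectors.

Section DoubledProgram.
Variables (R : realType) (m n : nat) (P : binprog R m n).
Implicit Types (x y z : 'cV[bool]_n) (eps : R).

Let value x : R := dot (obj P) (realv R x).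
Let weight z : R := dot (ones R n) (realv R z).

Lemma OptP x :
  reflect (x \in Fes P /\ {in Fes P, forall y, value y <= value x})
          (x \in Opt P).
Proof.
rewrite [x \in Opt P]in_set.
apply: (iffP andP) => [[xF /forall_inP xmax]|[xF xmax]];
  by split=> //; apply/forall_inP.
Qed.

Lemma Opt_neq0 : Fes P != set0 -> exists x, x \in Opt P.
Proof.
case/set0Pn => x0 x0F; case: (arg_maxP value x0F) => x xF xmax.
by exists x; apply/OptP.
Qed.

Lemma uniform_gap v : exists2 eps : R, 0 < eps &
  forall x, value x < v -> eps * n%:R < v - value x.
Proof.
pose d := \big[Num.min/1]_(x : 'cV[bool]_n | value x < v) (v - value x).
have d_gt0 : 0 < d by apply: lt_bigmin => // x; rewrite subr_gt0.
(* dividing by [n + 1] rather than [n] gives a strict bound and allows n = 0 *)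
exists (d / n.+1%:R) => [|x xv]; first by rewrite divr_gt0 ?ltr0Sn.
apply: lt_le_trans (_ : d <= _); last exact: bigmin_le_cond.
by rewrite mulrAC ltr_pdivrMr ?ltr0Sn // ltr_pM2l // ltr_nat.
Qed.

Lemma le_optdiam x y : x \in Opt P -> y \in Opt P ->
  enorm (realv R x - realv R y) ^+ 2 <= optdiam P.
Proof.
move=> xO yO; apply: le_trans (le_bigmax_cond _ _ xO).
exact: (le_bigmax_cond _ (fun y => enorm (realv R x - realv R y) ^+ 2) yO).
Qed.

Lemma optdiam_le d : 0 <= d ->
  {in Opt P &, forall x y, enorm (realv R x - realv R y) ^+ 2 <= d} ->
  optdiam P <= d.
Proof.
move=> d_ge0 dP; apply: bigmax_le => // x xO; apply: bigmax_le => // y yO.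
exact: dP.
Qed.

Lemma agree_Fes_BPD eps x y : x \in Fes P -> y \in Fes P ->
  concat3 x y (agree x y) \in Fes (BPD P eps).
Proof.
move=> xF yF; rewrite in_Fes_BPD xF yF /=.
apply/andP; split; apply/forallP => i;
  by rewrite !mxE; case: (x i ord0); case: (y i ord0) => /=; lra.
Qed.

Lemma Fes_BPDbar_of_BPD eps x y z :
  concat3 x y z \in Fes (BPD P eps) -> concat3 x y z \in Fes (BPDbar P eps).
Proof. by rewrite in_Fes_BPD in_Fes_BPDbar => /and4P[-> -> -> _]. Qed.

(** The second linking constraint forces [z] to be 1 where [x] and [y] are both
    0, and the first one where they are both 1. *)
Lemma agree_le_Fes_BPD eps x y z : concat3 x y z \in Fes (BPD P eps) ->
  weight (agree x y) <= weight z.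
Proof.
rewrite in_Fes_BPD => /and4P[_ _ /forallP le1 /forallP ge1].
rewrite /weight !dot_ones; apply: ler_sum => i _.
move: (le1 i) (ge1 i); rewrite !mxE.
by case: (x i ord0); case: (y i ord0); case: (z i ord0) => /=; lra.
Qed.

Definition small_penalty eps :=
  forall x y, x \in Fes P -> y \in Opt P -> value x < value y ->
  eps * n%:R < value y - value x.

Lemma small_penalty_exists : Fes P != set0 ->
  exists2 eps, 0 < eps & small_penalty eps.
Proof.
case/Opt_neq0 => x0 /OptP[x0F x0max].
have [eps eps_gt0 gap] := uniform_gap (value x0).
exists eps => // x y xF /OptP[yF ymax] lt_xy.
have -> : value y = value x0 by apply/le_anti; rewrite x0max //= ymax.
by apply: gap; apply: lt_le_trans lt_xy (x0max _ yF).
Qed.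

(** Optimality in either doubled program is used only through comparison with
    optimal pairs completed by their agreement vectors, so that one argument
    serves both programs. *)
Lemma dominating_triple eps x y z :
    0 < eps -> small_penalty eps -> Fes P != set0 ->
    x \in Fes P -> y \in Fes P ->
    {in Opt P &, forall x' y',
      dot (obj (BPD P eps)) (realv R (concat3 x' y' (agree x' y'))) <=
      dot (obj (BPD P eps)) (realv R (concat3 x y z))} ->
  [/\ x \in Opt P, y \in Opt P & optdiam P <= n%:R - weight z].
Proof.
move=> eps_gt0 gap Fes_neq0 xF yF dom.
have {}dom x' y' : x' \in Opt P -> y' \in Opt P ->
    value x' + value y' - eps * weight (agree x' y') <=
    value x + value y - eps * weight z.
  by move=> x'O y'O; move: (dom _ _ x'O y'O); rewrite !obj_BPD !dotDr.
have [x0 x0O] := Opt_neq0 Fes_neq0; have [x0F x0max] := OptP _ x0O.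
have x_le := x0max _ xF; have y_le := x0max _ yF.
have z_ge0 : 0 <= eps * weight z by rewrite mulr_ge0 ?dot_ones_ge0 ?ltW.
have a_le : eps * weight (agree x0 x0) <= eps * n%:R.
  by rewrite ler_wpM2l ?dot_ones_le ?ltW.
have dom0 := dom _ _ x0O x0O.
have xval : value x = value x0.
  apply/eqP; rewrite eq_le x_le /= leNgt; apply/negP => lt_x.
  by have := gap _ _ xF x0O lt_x; lra.
have yval : value y = value x0.
  apply/eqP; rewrite eq_le y_le /= leNgt; apply/negP => lt_y.
  by have := gap _ _ yF x0O lt_y; lra.
split; [by apply/OptP; rewrite xval | by apply/OptP; rewrite yval |].
apply: optdiam_le => [|x' y' x'O y'O]; first by rewrite subr_ge0 dot_ones_le.
rewrite enorm_sub_agree lerD2l lerN2 -(ler_pM2l eps_gt0).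
have [_ x'max] := OptP _ x'O; have [_ y'max] := OptP _ y'O.
have := dom _ _ x'O y'O; have := x'max _ x0F; have := y'max _ x0F.
by rewrite xval yval /weight; lra.
Qed.

End DoubledProgram.

Theorem theorem2p3 (R : realType) (m n : nat)
    (A : 'M[R]_(m, n)) (b : 'cV[R]_m) (c : 'cV[R]_n)
    (hfes : Fes (BinProg A b c) != set0) :
  (exists eps : R, 0 < eps /\
     forall x y z : 'cV[bool]_n,
       concat3 x y z \in Opt (BPD (BinProg A b c) eps) ->
       optdiam (BinProg A b c) = n%:R - dot (ones R n) (realv R z))
  /\
  (exists eps : R, 0 < eps /\
     forall x y z : 'cV[bool]_n,
       concat3 x y z \in Opt (BPDbar (BinProg A b c) eps) ->
       optdiam (BinProg A b c) <= n%:R - dot (ones R n) (realv R z)).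
Proof.
have [eps eps_gt0 gap] := small_penalty_exists hfes.
split; exists eps; split=> // x y z /OptP[zF zmax].
- have := zF; rewrite in_Fes_BPD => /and4P[xF yF _ _].
  have [|xO yO diam_le] := dominating_triple (z := z) eps_gt0 gap hfes xF yF.
    move=> x' y' /OptP[x'F _] /OptP[y'F _].
    by apply: zmax; apply: agree_Fes_BPD.
  apply/le_anti; rewrite diam_le /=.
  apply: le_trans (le_optdiam xO yO).
  by rewrite enorm_sub_agree lerD2l lerN2; apply: agree_le_Fes_BPD zF.
- have := zF; rewrite in_Fes_BPDbar => /and3P[xF yF _].
  have [|//] := dominating_triple (z := z) eps_gt0 gap hfes xF yF.
  move=> x' y' /OptP[x'F _] /OptP[y'F _]; rewrite -obj_BPDbar.
  by apply: zmax; apply: Fes_BPDbar_of_BPD; apply: agree_Fes_BPD.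
Qed.
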